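(* Let $0<\alpha<\delta<1$ and $t>0$. Then $$_{-\infty }I_{t}^{\alpha }\left\vert t\right\vert ^{-\delta }=\frac{\Gamma(\delta-\alpha)}{\Gamma(\delta)}\,\frac{\cos\left(\frac{\pi\delta}{2}-\pi\alpha\right)}{\cos\left(\frac{\pi\delta}{2}\right)}\,t^{\alpha-\delta},$$ that is, $$\frac{1}{\Gamma(\alpha)}\int_{-\infty}^{t}(t-\tau)^{\alpha-1}|\tau|^{-\delta}\,d\tau=\frac{\Gamma(\delta-\alpha)}{\Gamma(\delta)}\,\frac{\cos\left(\frac{\pi\delta}{2}-\pi\alpha\right)}{\cos\left(\frac{\pi\delta}{2}\right)}\,t^{\alpha-\delta}.$$
   Context: For $\alpha>0$ the Weyl fractional integral of a function $f$ is $_{-\infty }I_{t}^{\alpha }f(t)=\frac{1}{\Gamma(\alpha)}\int_{-\infty}^{t}(t-\tau)^{\alpha-1}f(\tau)\,d\tau$. Here $\Gamma$ is Euler's gamma function. *)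

(* Defs.v *)
From HB Require Import structures.
From mathcomp Require Import all_boot all_order all_algebra.
From mathcomp Require Import all_classical all_reals all_analysis.
Set Implicit Arguments. Unset Strict Implicit. Unset Printing Implicit Defensive.
Import Order.TTheory GRing.Theory Num.Theory.
Import numFieldNormedType.Exports.
Local Open Scope classical_set_scope.
Local Open Scope ring_scope.

(* Euler's Gamma function, defined by the Euler integral
   Gamma(s) = int_0^oo x^(s-1) e^(-x) dx (Lebesgue integral);
   this is the genuine Gamma function for s > 0, the only arguments used. *)
Definition Gamma {R : realType} (s : R) : R :=
  fine (\int[(@lebesgue_measure R)]_(x in `]0%R, +oo[)
          ((x `^ (s - 1)) * expR (- x))%:E)%E.

Definition weyl_integral {R : realType} (alpha : R) (f : R -> R) (t : R)
  : \bar R :=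
  ((Gamma alpha)^-1)%:E *
  (\int[(@lebesgue_measure R)]_(tau in `]-oo, t])
      (((t - tau) `^ (alpha - 1)) * f tau)%:E)%E.

(* Main.v *)
Require Import Defs.
From HB Require Import structures.
From mathcomp Require Import all_boot all_order all_algebra.
From mathcomp Require Import all_classical all_reals all_analysis.
From mathcomp Require Import measurable_realfun ring lra.
Import Order.TTheory GRing.Theory Num.Theory.
Import numFieldNormedType.Exports.
Local Open Scope classical_set_scope.
Local Open Scope ring_scope.

(** Write beta(a, b) for the integral of [u^(a-1) (1+u)^(-(a+b))] over
    [u > 0].  The substitutions [tau = t u / (1+u)] on [0 < tau < t] and
    [tau = - t u] on [tau < 0] turn the Weyl integral into
    [t^(alpha-delta) (beta(1-delta, alpha) + beta(1-delta, delta-alpha))], and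
    Tonelli's theorem gives [Gamma a Gamma b = beta(a, b) Gamma (a+b)].  With
    the reflection formula [Gamma s Gamma (1-s) = pi / sin (pi s)] the claim
    becomes a sum-to-product identity.

    The reflection formula is proved by Herglotz' trick applied to the square of
    [B s = beta(s, 1-s)].  By Mellin convolution, [(B s)^2] is the integral of
    [z^(s-1) L(z)] with [L(z) = ln z / (z-1)]; the substitution [z = w^2] and
    [(1+w) L(w^2) = 2 L(w)] give
    [B(s/2)^2 + B((s+1)/2)^2 = 4 B(s)^2], which [(pi / sin (pi s))^2] satisfies
    too.  The difference of the two is [O(1/s + 1/(1-s))], and on functions with
    such a bound the equation is a contraction of ratio 3/4. *)

(** * Integrals over the open half-line *)

Section half_line.
Context {R : realType}.
Implicit Types (f g : R -> R).
Let mu := @lebesgue_measure R.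

(** Valued in the extended reals, so that identities between nonnegative integrals can be proved
    before any finiteness is known. *)
Definition pint (f : R -> R) : \bar R :=
  (\int[@lebesgue_measure R]_(x in `]0%R, +oo[) (f x)%:E)%E.

Lemma eq_pint f g : (forall x : R, 0 < x -> f x = g x) -> pint f = pint g.
Proof.
by move=> fg; apply: eq_integral => x; rewrite inE/= in_itv/= andbT => /fg ->.
Qed.

Lemma pint_ge0 f : (forall x : R, 0 < x -> 0 <= f x) -> (0 <= pint f)%E.
Proof.
move=> f0; apply: integral_ge0 => x /=; rewrite in_itv/= andbT => /f0.
by rewrite lee_fin.
Qed.

Lemma le_pint f g : measurable_fun setT f -> measurable_fun setT g ->
  (forall x : R, 0 < x -> 0 <= f x) -> (forall x : R, 0 < x -> f x <= g x) ->
  (pint f <= pint g)%E.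
Proof.
move=> mf mg f0 fg; apply: ge0_le_integral => //=.
- by move=> x; rewrite in_itv/= andbT lee_fin => /f0.
- by apply/measurable_EFinP; exact: measurable_funTS.
- by apply/measurable_EFinP; exact: measurable_funTS.
- by move=> x; rewrite in_itv/= andbT lee_fin => /fg.
Qed.

Lemma pintD f g : measurable_fun setT f -> measurable_fun setT g ->
  (forall x : R, 0 < x -> 0 <= f x) -> (forall x : R, 0 < x -> 0 <= g x) ->
  (pint (fun x => f x + g x)%R = pint f + pint g)%E.
Proof.
move=> mf mg f0 g0; rewrite /pint -ge0_integralD//=.
- by move=> x; rewrite in_itv/= andbT lee_fin => /f0.
- by apply/measurable_EFinP; exact: measurable_funTS.
- by move=> x; rewrite in_itv/= andbT lee_fin => /g0.
- by apply/measurable_EFinP; exact: measurable_funTS.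
Qed.

Lemma pintZ (k : R) f : 0 <= k -> measurable_fun setT f ->
  (forall x : R, 0 < x -> 0 <= f x) ->
  (pint (fun x => k * f x)%R = k%:E * pint f)%E.
Proof.
move=> k0 mf f0; rewrite /pint -ge0_integralZl_EFin//=.
- by move=> x; rewrite in_itv/= andbT lee_fin => /f0.
- by apply/measurable_EFinP; exact: measurable_funTS.
Qed.

Let P : set R := `]0%R, +oo[%classic.
(** Extension by zero off the open quadrant, which brings integrals over half-lines under Tonelli's
    theorem on the whole plane. *)
Let restr (h : R -> R -> R) (z : R * R) : \bar R :=
  (h z.1 z.2 * \1_P z.1 * \1_P z.2)%:E.

Let restr_ge0 h z : (forall x y, 0 < x -> 0 < y -> 0 <= h x y) ->
  (0 <= restr h z)%E.
Proof.
move=> h0; rewrite lee_fin !indicE.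
have [/set_mem|_] := boolP (z.1 \in P); last by rewrite mulr0 mul0r.
have [/set_mem|_] := boolP (z.2 \in P); last by rewrite mulr0.
by rewrite /P/= !in_itv/= !andbT !mulr1 => z2 z1; exact: h0.
Qed.

Let measurable_restr (h : R -> R -> R) :
  measurable_fun setT (fun z : R * R => h z.1 z.2) ->
  measurable_fun setT (restr h).
Proof.
move=> mh.
have mP : measurable_fun setT (\1_P : R -> R).
  by apply: measurable_indic; exact: measurable_itv.
have m1 := measurableT_comp mP (@measurable_fst _ _ R R).
have m2 := measurableT_comp mP (@measurable_snd _ _ R R).
apply/measurable_EFinP.
exact: (measurable_funM (measurable_funM mh m1) m2).
Qed.

Let integral_restr1 (h : R -> R -> R) x :
  (\int[mu]_y restr h (x, y) = ((fun x => pint (h x)) \_ P) x)%E.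
Proof.
rewrite patchE /restr /=; case: ifPn => xP.
  rewrite /pint [RHS]integral_mkcond; apply: eq_integral => y _.
  rewrite patchE -/P !indicE xP mulr1.
  by case: (y \in P); rewrite ?mulr1 ?mulr0.
by apply: integral0_eq => y _; rewrite !indicE (negbTE xP) mulr0 mul0r.
Qed.

Let integral_restr2 (h : R -> R -> R) y :
  (\int[mu]_x restr h (x, y) = ((fun y => pint (h^~ y)) \_ P) y)%E.
Proof.
rewrite patchE /restr /=; case: ifPn => yP.
  rewrite /pint [RHS]integral_mkcond; apply: eq_integral => x _.
  rewrite patchE -/P !indicE yP mulr1.
  by case: (x \in P); rewrite ?mulr1 ?mulr0.
by apply: integral0_eq => x _; rewrite !indicE (negbTE yP) mulr0.
Qed.

Lemma measurable_pint (h : R -> R -> R) :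
  measurable_fun setT (fun z : R * R => h z.1 z.2) ->
  (forall x y, 0 < x -> 0 < y -> 0 <= h x y) ->
  measurable_fun (`]0%R, +oo[%classic : set R) (fun x => pint (h x)).
Proof.
move=> mh h0; apply/(measurable_restrictT _ _).2; first exact: measurable_itv.
have := measurable_fun_fubini_tonelli_F (m2 := mu) _ (measurable_restr _ mh)
  (fun z => restr_ge0 _ z h0).
rewrite /fubini_F; under eq_fun do rewrite integral_restr1; exact.
Qed.

Lemma pint_tonelli (h : R -> R -> R) :
  measurable_fun setT (fun z : R * R => h z.1 z.2) ->
  (forall x y, 0 < x -> 0 < y -> 0 <= h x y) ->
  (\int[@lebesgue_measure R]_(x in `]0%R, +oo[) pint (h x) =
   \int[@lebesgue_measure R]_(y in `]0%R, +oo[) pint (h ^~ y))%E.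
Proof.
move=> mh h0; have fub := fubini_tonelli (m1 := mu) (m2 := mu) _
  (measurable_restr _ mh) (fun z => restr_ge0 _ z h0).
rewrite [RHS]integral_mkcond [LHS]integral_mkcond.
transitivity (\int[mu]_x \int[mu]_y restr h (x, y))%E.
  by apply: eq_integral => x _; rewrite integral_restr1.
by rewrite fub; apply: eq_integral => y _; rewrite integral_restr2.
Qed.

Lemma pintM f g : measurable_fun setT f -> measurable_fun setT g ->
  (forall x, 0 <= f x) -> (forall x, 0 <= g x) ->
  (pint f * pint g =
   \int[@lebesgue_measure R]_(x in `]0%R, +oo[) pint (fun y => f x * g y)%R)%E.
Proof.
move=> mf mg f0 g0.
under [RHS]eq_integral do rewrite pintZ//.
rewrite [RHS]ge0_integralZr//=.
- by apply/measurable_EFinP; exact: measurable_funTS.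
- by move=> x _; rewrite lee_fin.
- exact: pint_ge0.
Qed.

(** The compact intervals [[lo n, hi n]] exhaust the half-line; [n.+2] in [hi] keeps [lo n < hi n]
    at [n = 0]. *)
Let lo (n : nat) : R := n.+1%:R^-1.
Let hi (n : nat) : R := n.+2%:R.

Let lo_gt0 n : 0 < lo n. Proof. by rewrite invr_gt0. Qed.
Let lo_lt_hi n : lo n < hi n.
Proof.
by apply: (@le_lt_trans _ _ 1); [rewrite invf_le1// ler1n|rewrite ltr1n].
Qed.
Let lo_cvg : lo n @[n --> \oo] --> (0 : R).
Proof. exact: cvg_harmonic. Qed.
Let hi_cvg : hi n @[n --> \oo] --> +oo.
Proof.
apply/cvgryPge => M; near=> n; apply: (@le_trans _ _ n%:R).
  by near: n; exact: nbhs_infty_ger.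
by rewrite ler_nat -addn2 leq_addr.
Unshelve. all: by end_near. Qed.

Let nd_lohi : nondecreasing_seq (fun n => `[lo n, hi n]%classic).
Proof.
apply/nondecreasing_seqP => n; rewrite subsetEset; apply: subset_itv.
- by rewrite bnd_simp lef_pV2 ?posrE// ler_nat.
- by rewrite bnd_simp ler_nat.
Qed.

Let bigcup_lohi : \bigcup_n `[lo n, hi n]%classic = `]0, +oo[%classic.
Proof.
apply/seteqP; split=> x /=.
  move=> [n _] /=; rewrite !in_itv/= andbT => /andP[+ _].
  exact: lt_le_trans.
rewrite in_itv/= andbT => x0.
have [n Hn] : exists n : nat, x <= n%:R /\ x^-1 <= n%:R.
  (* Both terms are positive, so an integer above their sum exceeds each of them. *)
  exists (Num.bound (x + x^-1)).
  have x'0 : 0 < x^-1 by rewrite invr_gt0.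
  have := archi_boundP (ltW (addr_gt0 x0 x'0)); lra.
exists n => //=; rewrite in_itv/=; apply/andP; split.
  rewrite -[leRHS]invrK lef_pV2 ?posrE ?invr_gt0//.
  by rewrite (le_trans Hn.2)// ler_nat.
by rewrite (le_trans Hn.1)// ler_nat// leqW.
Qed.

Lemma continuous_pint_cvg f : (forall x : R, 0 < x -> {for x, continuous f}) ->
  (forall x : R, 0 < x -> 0 <= f x) ->
  (\int[mu]_(x in `[lo n, hi n]) (f x)%:E @[n --> \oo] --> pint f)%E.
Proof.
move=> cf f0; rewrite /pint -bigcup_lohi.
have mf : measurable_fun (`]0, +oo[%classic : set R) (EFin \o f).
  apply/measurable_EFinP; apply: open_continuous_measurable_fun => //.
  by apply/in_setP => x/=; rewrite in_itv/= andbT => /cf.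
have sub n : `[lo n, hi n]%classic `<=` `]0, +oo[%classic.
  by rewrite -bigcup_lohi => x xn; exists n.
apply: ge0_nondecreasing_set_cvg_integral => //.
- by move=> n; apply: measurable_funS mf => //; exact: sub.
- by move=> n x /sub /=; rewrite in_itv/= andbT lee_fin => /f0.
Qed.

(** Monotone convergence along the compact exhaustion reduces this to the theorem on each
    [[lo n, hi n]]; as [f] is nonnegative, integrability is a conclusion. *)
Lemma pint_FTC f (F : R -> R) (l m : R) :
  (forall x : R, 0 < x -> {for x, continuous f}) ->
  (forall x : R, 0 < x -> 0 <= f x) ->
  (forall x : R, 0 < x -> is_derive x 1 F (f x)) ->
  F x @[x --> 0^'+] --> l -> F x @[x --> +oo] --> m ->
  pint f = (m - l)%:E.
Proof.
move=> cf f0 dF Fl Fm.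
have FE n : (\int[mu]_(x in `[lo n, hi n]) (f x)%:E =
    (F (hi n) - F (lo n))%:E)%E.
  have cF (x : R) : 0 < x -> {for x, continuous F}.
    move=> /dF H; apply/differentiable_continuous/derivable1_diffP.
    by apply: ex_derive; exact: H.
  apply: continuous_FTC2 => //.
  - apply/continuous_in_subspaceT => x; rewrite inE/= in_itv/= => /andP[lx _].
    by apply: cf; exact: lt_le_trans lx.
  - split.
    + move=> x; rewrite in_itv/= => /andP[lx _].
      have H := dF x (lt_trans (lo_gt0 n) lx); exact: ex_derive.
    + by apply/cvg_at_right_filter/cF.
    + by apply/cvg_at_left_filter/cF; rewrite (lt_trans (lo_gt0 n)).
  - move=> x; rewrite in_itv/= => /andP[lx _].
    by have H := dF x (lt_trans (lo_gt0 n) lx); rewrite derive1E derive_val.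
have := continuous_pint_cvg _ cf f0.
under eq_fun do rewrite FE.
move=> /cvg_lim <-//; apply/cvg_lim => //.
apply: cvg_EFin; first by near=> n.
apply: cvgB.
- by have /cvg_pinftyP := Fm; apply.
- by have /cvg_at_rightP := Fl; apply.
Unshelve. all: by end_near. Qed.

(** Both sides are monotone limits: of integrals over [[lo n, hi n]] and over the images of these
    intervals, which exhaust [B] because [F] increases onto it. Substitution on compact intervals
    matches the two sequences term by term. *)
Lemma pint_subst (B : interval R) (F F' G : R -> R) :
  (forall x : R, 0 < x -> is_derive x 1 F (F' x)) ->
  (forall x : R, 0 < x -> 0 < F' x) ->
  (forall x : R, 0 < x -> {for x, continuous F'}) ->
  F @` `]0, +oo[%classic = [set` B] ->
  (forall y, [set` B] y -> {for y, continuous G}) ->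
  (forall y, [set` B] y -> 0 <= G y) ->
  (\int[mu]_(y in [set` B]) (G y)%:E = pint (fun x => G (F x) * F' x)%R)%E.
Proof.
move=> dF F'0 cF' FB cG G0.
have BF (x : R) : 0 < x -> [set` B] (F x).
  by move=> x0; rewrite -FB; exists x => //=; rewrite in_itv/= andbT.
have cF (x : R) : 0 < x -> {for x, continuous F}.
  move=> /dF H; apply/differentiable_continuous/derivable1_diffP.
  by apply: ex_derive; exact: H.
have dFE (x : R) : 0 < x -> derive1 F x = F' x.
  by move=> /dF H; rewrite derive1E derive_val.
(* [derive1 F] is known to agree with [F'] only on the half-line; this is open, so agreement near
   [x] transfers continuity. *)
have cdF (x : R) : 0 < x -> {for x, continuous (derive1 F)}.
  move=> x0; rewrite /prop_for /continuous_at dFE//.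
  apply: cvg_trans (cF' _ x0); apply: near_eq_cvg.
  by near=> y; rewrite dFE//; near: y; exact: lt_nbhsr.
have incrF (x y : R) : 0 < x -> x < y -> F x < F y.
  move=> x0 xy; apply: (@gtr0_derive1_lt_cc _ F x y) => //.
  - move=> z; rewrite in_itv/= => /andP[xz _].
    by have H := dF z (lt_trans x0 xz); exact: ex_derive.
  - move=> z; rewrite in_itv/= => /andP[xz _].
    by rewrite dFE ?F'0 ?(lt_trans x0 xz).
  - apply/continuous_in_subspaceT => z; rewrite inE/= in_itv/= => /andP[xz _].
    by apply: cF; exact: lt_le_trans xz.
  - by rewrite in_itv/= lexx ltW.
  - by rewrite in_itv/= lexx ltW.
have leF (x y : R) : 0 < x -> x <= y -> F x <= F y.
  by move=> x0; rewrite le_eqVlt => /predU1P[->//|/(incrF _ _ x0)/ltW].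
have subB n : `[F (lo n), F (hi n)]%classic `<=` [set` B].
  have h0 : 0 < hi n by rewrite (lt_trans (lo_gt0 n)).
  by move=> y; apply: interval_is_interval => //; exact: BF.
have bigB : \bigcup_n `[F (lo n), F (hi n)]%classic = [set` B].
  apply/seteqP; split; first by move=> y [n _]; exact: subB.
  rewrite -FB => _ [x /= x0 <-].
  have : `]0, +oo[%classic x by [].
  rewrite -bigcup_lohi => -[n _ /=]; rewrite in_itv/= => /andP[nx xn].
  exists n => //=; rewrite in_itv/= !leF//.
  by move: x0; rewrite in_itv/= andbT.
have ndB : nondecreasing_seq (fun n => `[F (lo n), F (hi n)]%classic).
  apply/nondecreasing_seqP => n; rewrite subsetEset; apply: subset_itv.
  - by rewrite bnd_simp leF// lef_pV2 ?posrE// ler_nat.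
  - by rewrite bnd_simp leF// ?ler_nat// (lt_trans (lo_gt0 n)).
have H1 : (\int[mu]_(x in `[F (lo n), F (hi n)]) (G x)%:E @[n --> \oo] -->
   \int[mu]_(y in [set` B]) (G y)%:E)%E.
  rewrite -bigB; apply: ge0_nondecreasing_set_cvg_integral => //.
  - move=> n; apply/measurable_EFinP.
    apply: subspace_continuous_measurable_fun => //.
    apply/continuous_in_subspaceT => y; rewrite inE => /subB; exact: cG.
  - by move=> n x /subB; rewrite lee_fin => /G0.
have H2 : (\int[mu]_(x in `[lo n, hi n]) (G (F x) * F' x)%:E @[n --> \oo] -->
   pint (fun x => G (F x) * F' x)%R)%E.
  apply: continuous_pint_cvg.
  - move=> x x0; apply: (@cvgM _ R); last exact: cF'.
    by apply: (continuous_comp (cF _ x0)); apply: cG; exact: BF.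
  - by move=> x x0; rewrite mulr_ge0// ?G0 ?(ltW (F'0 _ _))//; exact: BF.
apply: cvg_unique H1 _ => //; apply: cvg_trans H2.
apply: near_eq_cvg; near=> n.
have gt0 (x : R) : lo n <= x -> 0 < x by exact: lt_le_trans.
rewrite [RHS](@integration_by_substitution_increasing _ F G)//.
- apply: eq_integral => x; rewrite inE/= in_itv/= => /andP[/gt0 x0 _].
  by rewrite fctE /= dFE.
- exact: ltW.
- by move=> x y; rewrite in_itv/= => /andP[/gt0 x0 _] _; exact: incrF.
- by move=> x; rewrite in_itv/= => /andP[/ltW /gt0 x0 _]; exact: cdF.
- by apply/cvg_ex; exists (derive1 F (lo n)); apply/cvg_at_right_filter/cdF.
- apply/cvg_ex; exists (derive1 F (hi n)); apply/cvg_at_left_filter/cdF.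
  by rewrite (lt_trans (lo_gt0 n)).
- split.
  + move=> x; rewrite in_itv/= => /andP[/ltW/gt0 x0 _].
    have H := dF x x0; exact: ex_derive.
  + by apply/cvg_at_right_filter/cF.
  + by apply/cvg_at_left_filter/cF; rewrite (lt_trans (lo_gt0 n)).
- apply/continuous_in_subspaceT => y; rewrite inE => /subB; exact: cG.
Unshelve. all: by end_near. Qed.

End half_line.

(* Dispatching on the syntactic shape keeps higher-order unification from
   diverging on the closure lemmas; likewise for [continuous_tac]. *)
Ltac measurable_tac :=
  lazymatch goal with
  | |- measurable_fun _ (fun x => (@?f x) * (@?g x)) =>
      apply: (@measurable_funM _ _ _ _ f g); measurable_tac
  | |- measurable_fun _ (fun x => (@?f x) + (@?g x)) =>
      apply: (@measurable_funD _ _ _ _ f g); measurable_tac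
  | |- measurable_fun _ (fun x => - (@?f x)) =>
      apply: (@measurable_funN _ _ _ _ f); measurable_tac
  | |- measurable_fun _ (fun x => (@?f x) `^ ?p) =>
      apply: (measurableT_comp (@measurable_powR _ p)
        (_ : measurable_fun setT f)); [measurable_tac]
  | |- measurable_fun _ (fun x => expR (@?f x)) =>
      apply: (measurableT_comp (@measurable_expR _)
        (_ : measurable_fun setT f)); [measurable_tac]
  | |- measurable_fun _ fst => exact: measurable_fst
  | |- measurable_fun _ snd => exact: measurable_snd
  | |- measurable_fun _ (fun x => x.1) => exact: measurable_fst
  | |- measurable_fun _ (fun x => x.2) => exact: measurable_snd
  | |- _ => first [exact: measurable_id | exact: measurable_cst | idtac]
  end.

(** * Derivative and continuity rules for real powers *)

Section calculus.
Context {R : realType}.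
Implicit Types (f g : R -> R) (x : R).

Lemma is_derive_continuous f x (d : R) :
  is_derive x 1 f d -> {for x, continuous f}.
Proof.
move=> H; apply/differentiable_continuous/derivable1_diffP.
by apply: ex_derive; exact: H.
Qed.

Lemma gt0_powRD x (p q : R) : 0 < x -> x `^ (p + q) = x `^ p * x `^ q.
Proof. by move=> x0; rewrite powRD// (gt_eqF x0) implybT. Qed.

Lemma for_continuousM f g x : {for x, continuous f} -> {for x, continuous g} ->
  {for x, continuous (fun y => f y * g y)}.
Proof. exact: cvgM. Qed.

Lemma for_continuousD f g x : {for x, continuous f} -> {for x, continuous g} ->
  {for x, continuous (fun y => f y + g y)}.
Proof. exact: cvgD. Qed.

Lemma for_continuousN f x : {for x, continuous f} ->
  {for x, continuous (fun y => - f y)}.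
Proof. exact: cvgN. Qed.

Lemma for_continuous_powR (p : R) f x : 0 < f x -> {for x, continuous f} ->
  {for x, continuous (fun y => f y `^ p)}.
Proof.
move=> f0 cf; apply: (@continuous_comp _ _ _ f (@powR R ^~ p)) => //.
by apply: is_derive_continuous; exact: is_derive1_powR.
Qed.

Lemma for_continuous_expR f x : {for x, continuous f} ->
  {for x, continuous (fun y => expR (f y))}.
Proof. move=> cf; apply: (@continuous_comp _ _ _ f (@expR R)) => //.
exact: continuous_expR. Qed.

Lemma is_derive_powR (p : R) f (d : R) x : 0 < f x -> is_derive x 1 f d ->
  is_derive x 1 (fun y => f y `^ p) (p * f x `^ (p - 1) * d).
Proof.
move=> f0 df; apply: (@is_derive1_comp _ (@powR R ^~ p)) => //.
exact: is_derive1_powR.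
Qed.

Lemma is_derive_addc (c : R) x : is_derive x 1 (fun y => c + y) 1.
Proof. by rewrite -[X in is_derive _ _ _ X]add0r; apply: is_deriveD. Qed.

Lemma is_derive_mulc (c : R) x : is_derive x 1 (fun y => c * y) c.
Proof. by rewrite -[X in is_derive _ _ _ X]mulr1; apply: is_deriveZ. Qed.

End calculus.

Ltac continuous_tac :=
  lazymatch goal with
  | |- {for _, continuous (fun x => (@?f x) * (@?g x))} =>
      apply: (for_continuousM f g); continuous_tac
  | |- {for _, continuous (fun x => (@?f x) + (@?g x))} =>
      apply: (for_continuousD f g); continuous_tac
  | |- {for _, continuous (fun x => - (@?f x))} =>
      apply: (for_continuousN f); continuous_tac
  | |- {for _, continuous (fun x => (@?f x) `^ ?p)} =>
      apply: (for_continuous_powR p f); [idtac|continuous_tac]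
  | |- {for _, continuous (fun x => expR (@?f x))} =>
      apply: (for_continuous_expR f); continuous_tac
  | |- {for _, continuous _} =>
      first [exact: cvg_id | exact: cvg_cst | idtac]
  | |- _ => idtac
  end.


(** * Euler's Gamma and Beta integrals *)

Section gamma_beta.
Context {R : realType}.
Implicit Types (a b c s : R).

Lemma pint_scale c (G : R -> R) : 0 < c ->
  (forall y, 0 < y -> {for y, continuous G}) -> (forall y, 0 < y -> 0 <= G y) ->
  pint G = pint (fun x => G (c * x) * c).
Proof.
move=> c0 cG G0; apply: (pint_subst `]0, +oo[ (fun x => c * x) (fun=> c)) => //.
- by move=> x _; exact: is_derive_mulc.
- by move=> x _; exact: cvg_cst.
- apply/seteqP; split=> x /=; rewrite in_itv/= andbT.
    by move=> [y /=]; rewrite !in_itv/= !andbT => y0 <-; exact: mulr_gt0.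
  move=> x0; exists (c^-1 * x); 
    first by rewrite /= in_itv/= andbT mulr_gt0 ?invr_gt0.
  by rewrite mulrA divff ?mul1r// gt_eqF.
- by move=> y /=; rewrite in_itv/= andbT; exact: cG.
- by move=> y /=; rewrite in_itv/= andbT; exact: G0.
Qed.

Definition eGamma s : \bar R := pint (fun x => x `^ (s - 1) * expR (- x)).

(** Euler's Beta function on the half-line; [v = u / (1 + u)] gives its usual form on the unit
    interval. *)
Definition eBeta a b : \bar R :=
  pint (fun u => u `^ (a - 1) * (1 + u) `^ (- (a + b))).

Lemma eGamma_ge0 s : (0 <= eGamma s)%E.
Proof. by apply: pint_ge0 => x _; rewrite mulr_ge0 ?powR_ge0 ?expR_ge0. Qed.

Lemma eBeta_ge0 a b : (0 <= eBeta a b)%E.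
Proof. by apply: pint_ge0 => x _; rewrite mulr_ge0 ?powR_ge0. Qed.

Lemma eGamma_scale s c : 0 < c ->
  pint (fun y => y `^ (s - 1) * expR (- (c * y))) =
  ((c `^ (- s))%:E * eGamma s)%E.
Proof.
move=> c0; suff -> : eGamma s =
    ((c `^ s)%:E * pint (fun y => y `^ (s - 1) * expR (- (c * y)))%R)%E.
  by rewrite muleA -EFinM -gt0_powRD// addNr powRr0 mul1e.
rewrite /eGamma (pint_scale c)//; last 2 first.
  by move=> y y0; continuous_tac.
  by move=> y y0; rewrite mulr_ge0 ?powR_ge0 ?expR_ge0.
rewrite -pintZ ?powR_ge0//; last 2 first.
  by measurable_tac.
  by move=> x _; rewrite mulr_ge0 ?powR_ge0 ?expR_ge0.
apply: eq_pint => x x0; have -> : c `^ s = c `^ (s - 1) * c.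
  by rewrite -[X in _ = _ * X]powRr1 ?ltW// -gt0_powRD// subrK.
by rewrite powRM ?ltW//; ring.
Qed.

(** For fixed [y], the variable of the second factor is replaced by [y * u]. After the exchange of
    integrals, the one in [y] is [eGamma (a + b)] rescaled by [1 + u], which leaves the Beta
    integrand in [u]. *)
Lemma eGammaM a b : (eGamma b * eGamma a = eBeta a b * eGamma (a + b))%E.
Proof.
rewrite /eGamma pintM; last 4 first.
- by measurable_tac.
- by measurable_tac.
- by move=> x; rewrite mulr_ge0 ?powR_ge0 ?expR_ge0.
- by move=> x; rewrite mulr_ge0 ?powR_ge0 ?expR_ge0.
pose h (y u : R) := u `^ (a - 1) * (y `^ (a + b - 1) * expR (- ((1 + u) * y))).
transitivity (\int[@lebesgue_measure R]_(y in `]0%R, +oo[) pint (h y))%E.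
  apply: eq_integral => y; rewrite inE/= in_itv/= andbT => y0.
  rewrite pintZ; last 3 first.
  - by rewrite mulr_ge0 ?powR_ge0 ?expR_ge0.
  - by measurable_tac.
  - by move=> x; rewrite mulr_ge0 ?powR_ge0 ?expR_ge0.
  rewrite (pint_scale y)//; last 2 first.
    by move=> x x0; continuous_tac.
    by move=> x x0; rewrite mulr_ge0 ?powR_ge0 ?expR_ge0.
  rewrite -pintZ; last 3 first.
  - by rewrite mulr_ge0 ?powR_ge0 ?expR_ge0.
  - by measurable_tac.
  - by move=> x x0; rewrite !mulr_ge0 ?powR_ge0 ?expR_ge0// ltW.
  apply: eq_pint => u u0; rewrite /h powRM ?ltW//.
  have -> : a + b - 1 = (b - 1) + ((a - 1) + 1) by ring.
  rewrite (gt0_powRD y (b - 1))// (gt0_powRD y (a - 1) 1)//.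
  rewrite powRr1 ?ltW//.
  have -> : - ((1 + u) * y) = (- y) + (- (y * u)) by ring.
  by rewrite expRD; ring.
rewrite pint_tonelli; last 2 first.
- by rewrite /h; measurable_tac.
- by move=> x y _ _; rewrite /h !mulr_ge0 ?powR_ge0 ?expR_ge0.
rewrite -[in RHS]/(eGamma (a + b)) /eBeta /pint.
rewrite -ge0_integralZr//=; last 3 first.
- by apply/measurable_EFinP; apply: measurable_funTS; measurable_tac.
- by move=> x _; rewrite lee_fin mulr_ge0 ?powR_ge0.
- exact: eGamma_ge0.
apply: eq_integral => u; rewrite inE/= in_itv/= andbT => u0.
rewrite -/(pint _) /h pintZ ?powR_ge0//; last 2 first.
- by measurable_tac.
- by move=> x x0; rewrite mulr_ge0 ?powR_ge0 ?expR_ge0.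
by rewrite eGamma_scale ?addr_gt0// muleA -EFinM.
Qed.

End gamma_beta.

(** * Integrals with an elementary antiderivative *)

Section explicit_integrals.
Context {R : realType}.
Implicit Types (p s z : R).

Lemma cvgy_powRN p : 0 < p -> x `^ (- p) @[x --> +oo] --> (0 : R).
Proof.
move=> p0; apply/cvgrPdist_le => e e0; near=> x.
(* The threshold solves x^p = 1/e. *)
have e'0 : 0 < e^-1 `^ p^-1 by rewrite powR_gt0 ?invr_gt0.
have xe : e^-1 `^ p^-1 <= x by near: x; apply: nbhs_pinfty_ge; exact: num_real.
have x0 : 0 < x by exact: lt_le_trans xe.
rewrite sub0r normrN ger0_norm ?powR_ge0// powRN -[leRHS]invrK.
rewrite lef_pV2 ?posrE ?powR_gt0 ?invr_gt0//.
have : (e^-1 `^ p^-1) `^ p <= x `^ p.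
  by apply: ge0_ler_powR => //; rewrite ?nnegrE ltW.
by rewrite -powRrM mulVf ?gt_eqF// powRr1// invr_ge0 ltW.
Unshelve. all: by end_near. Qed.

Lemma cvgy_add_powRN p (c : R) : 0 < p ->
  (c + x) `^ (- p) @[x --> +oo] --> (0 : R).
Proof. by move=> p0; apply: cvg_comp (cvg_addrl c) (cvgy_powRN _ p0). Qed.

Lemma cvg0_add1_powR p : (1 + x) `^ p @[x --> (0 : R)^'+] --> (1 : R).
Proof.
apply: cvg_at_right_filter.
have : {for (0 : R), continuous (fun u : R => (1 + u) `^ p)}.
  by continuous_tac; rewrite addr0.
by rewrite /prop_for /continuous_at addr0 powR1.
Qed.

Lemma pint_expRN : pint (fun u : R => expR (- u)) = 1%E.
Proof.
have d (x : R) : 0 < x -> is_derive x 1 (fun u => - expR (- u)) (expR (- x)).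
  move=> x0; rewrite -[X in is_derive _ _ _ X]opprK; apply: is_deriveN.
  rewrite -[X in is_derive _ _ _ X]mulrN1.
  exact: (@is_derive1_comp _ (@expR R) -%R).
have -> : 1%E = (0 - - 1 : R)%:E by rewrite sub0r opprK.
apply: (pint_FTC _ _ _ _ _ _ d).
- by move=> x x0; continuous_tac.
- by move=> x _; exact: expR_ge0.
- apply: cvg_at_right_filter; apply: cvgN.
  have : {for (0 : R), continuous (fun u => expR (- u))} by continuous_tac.
  by rewrite /prop_for /continuous_at oppr0 expR0.
- by rewrite -[X in _ --> X]oppr0; apply: cvgN; exact: cvgr_expR.
Qed.

Lemma pint_add1_powR p : p < -1 ->
  pint (fun u : R => (1 + u) `^ p) = (- (p + 1)^-1)%:E.
Proof.
move=> p1; have p10 : p + 1 != 0 by rewrite lt_eqF//; lra.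
have d (x : R) : 0 < x ->
    is_derive x 1 (fun u => (p + 1)^-1 * (1 + u) `^ (p + 1))
    ((1 + x) `^ p).
  move=> x0; have x10 : 0 < 1 + x by lra.
  have := is_derive_powR (p + 1) _ _ x x10 (is_derive_addc 1 x).
  move=> /(is_deriveZ (p + 1)^-1)/is_derive_eq; apply.
  by rewrite mulr1 addrK /GRing.scale/= mulrA mulVf ?mul1r.
rewrite -sub0r; apply: (pint_FTC _ _ _ _ _ _ d).
- by move=> x x0; continuous_tac; lra.
- by move=> x _; exact: powR_ge0.
- rewrite -[X in _ --> X]mulr1; apply: cvgM; first exact: cvg_cst.
  exact: cvg0_add1_powR.
- rewrite -[X in _ --> X](mulr0 (p + 1)^-1); apply: cvgM; first exact: cvg_cst.
  by rewrite -[p + 1]opprK; apply: cvgy_add_powRN; lra.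
Qed.

(** This is beta(s, 1): the antiderivative (u / (1+u))^s / s runs from 0 to 1/s. *)
Lemma pint_powR_add1_powR s : 0 < s ->
  pint (fun u : R => u `^ (s - 1) * (1 + u) `^ (- s - 1)) = (s^-1)%:E.
Proof.
move=> s0.
have d (x : R) : 0 < x ->
    is_derive x 1 (fun u => s^-1 * (u `^ s * (1 + u) `^ (- s)))
    (x `^ (s - 1) * (1 + x) `^ (- s - 1)).
  move=> x0; have x10 : 0 < 1 + x by lra.
  have d1 := is_derive_powR (- s) _ _ x x10 (is_derive_addc 1 x).
  have d2 := is_derive1_powR s x0.
  have /is_derive_eq := is_deriveZ s^-1 (is_deriveM d2 d1); apply.
  rewrite /GRing.scale/= mulr1.
  have -> : x `^ s = x `^ (s - 1) * x.
    by rewrite -[X in _ = _ * X]powRr1 ?ltW// -gt0_powRD// subrK.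
  have -> : (1 + x) `^ (- s) = (1 + x) `^ (- s - 1) * (1 + x).
    by rewrite -[X in _ = _ * X]powRr1 ?ltW// -gt0_powRD// subrK.
  by field; rewrite gt_eqF.
rewrite -[s^-1]subr0.
apply: (pint_FTC _ _ _ _ _ _ d).
- by move=> x x0; continuous_tac; lra.
- by move=> x _; rewrite mulr_ge0 ?powR_ge0.
- rewrite -[X in _ --> X](mulr0 s^-1); apply: cvgM; first exact: cvg_cst.
  rewrite -[X in _ --> X](mul0r 1); apply: cvgM; first exact: powR_cvg0.
  exact: cvg0_add1_powR.
- rewrite -[X in _ --> X](mulr1 s^-1); apply: cvgM; first exact: cvg_cst.
  suff : u `^ s * (1 + u) `^ (- s) @[u --> +oo] --> (1 - 0 : R) `^ s.
    by rewrite subr0 powR1.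
  (* The quotient x / (1+x) is written as 1 - 1/(1+x), whose limit is immediate. *)
  have H : 1 - (1 + x) `^ (- 1) @[x --> +oo] --> (1 - 0 : R).
    by apply: cvgB; [exact: cvg_cst|exact: cvgy_add_powRN].
  have C : {for (1 - 0 : R), continuous (@powR R ^~ s)}.
    by apply: is_derive_continuous; apply: is_derive1_powR; rewrite subr0.
  apply: cvg_trans (@continuous_cvg _ _ _ _ _ _ _ _ C H).
  apply: near_eq_cvg; near=> x.
  have x0 : 0 < x by near: x; exact: nbhs_pinfty_gt.
  have x10 : 0 < 1 + x by lra.
  have /= -> : 1 - (1 + x) `^ (-1) = x * (1 + x) `^ (-1).
    by rewrite powR_inv1 ?ltW//; field; rewrite gt_eqF.
  by rewrite powRM ?powR_ge0 ?ltW// -powRrM mulN1r.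
Unshelve. all: by end_near. Qed.

End explicit_integrals.

(** * Euler's reflection formula *)

Section beta_duplication.
Context {R : realType}.
Implicit Types (r s x z : R).

(** The square of a Mellin transform is the transform of a multiplicative self-convolution: the
    inner variable becomes [z / x], and Tonelli makes [z] the outer one. *)
Lemma mellin_square r (k : R -> R) : measurable_fun setT k ->
  (forall x, 0 <= k x) -> (forall x, 0 < x -> {for x, continuous k}) ->
  (pint (fun x => x `^ (r - 1) * k x)%R * pint (fun x => x `^ (r - 1) * k x)%R =
   \int[@lebesgue_measure R]_(z in `]0%R, +oo[) pint (fun x =>
     z `^ (r - 1) * (x `^ (-1) * (k x * k (z * x `^ (- 1)))))%R)%E.
Proof.
move=> mk k0 ck.
have mf : measurable_fun setT (fun x : R => x `^ (r - 1) * k x).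
  by apply: measurable_funM => //; measurable_tac.
have f0 x : 0 <= x `^ (r - 1) * k x by rewrite mulr_ge0 ?powR_ge0.
rewrite (pintM _ _ mf mf f0 f0).
pose h (x z : R) := z `^ (r - 1) * (x `^ (-1) * (k x * k (z * x `^ (- 1)))).
have h0 x z : 0 <= h x z by rewrite !mulr_ge0 ?powR_ge0.
have mh : measurable_fun setT (fun z : R * R => h z.1 z.2).
  rewrite /h; measurable_tac.
    by apply: (measurableT_comp mk); exact: measurable_fst.
  apply: (measurableT_comp mk
    (_ : measurable_fun setT (fun z : R * R => z.2 * z.1 `^ (-1)))).
  by measurable_tac.
apply: etrans (pint_tonelli h mh (fun x z _ _ => h0 x z)).
apply: eq_integral => x; rewrite inE/= in_itv/= andbT => x0.
rewrite (pintZ _ _ (f0 x) mf (fun y _ => f0 y)).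
have x'0 : 0 < x `^ (-1) by rewrite powR_gt0.
rewrite (pint_scale (x `^ (-1)))//; last first.
  by move=> y y0; continuous_tac => //; exact: ck.
rewrite -pintZ; last 3 first.
- exact: f0.
- measurable_tac; apply: (measurableT_comp mk
    (_ : measurable_fun setT (fun z : R => x `^ (-1) * z))).
  by measurable_tac.
- by move=> y y0; rewrite !mulr_ge0 ?powR_ge0.
apply: eq_pint => z z0; rewrite /h powRM ?powR_ge0 ?ltW//.
have : x `^ (r - 1) * (x `^ (-1)) `^ (r - 1) = 1.
  by rewrite -powRrM -gt0_powRD// mulN1r subrr powRr0.
move=> H; rewrite (mulrC (x `^ (-1)) z) -[RHS]mul1r -[X in _ = X * _]H; ring.
Qed.

(** Partial fractions give the antiderivative [(ln (1 + x) - ln (z + x)) / (z - 1)]. *)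
Lemma pint_inv_mul z : 0 < z -> z != 1 ->
  pint (fun x => (1 + x) `^ (-1) * (z + x) `^ (-1)) = ((z - 1)^-1 * ln z)%:E.
Proof.
move=> z0 z1; have z10 : z - 1 != 0 by rewrite subr_eq0.
have d (x : R) : 0 < x ->
    is_derive x 1 (fun x => (z - 1)^-1 * (ln (1 + x) - ln (z + x)))
      ((1 + x) `^ (-1) * (z + x) `^ (-1)).
  move=> x0; have x1 : 0 < 1 + x by lra.
  have xz : 0 < z + x by lra.
  have d1 := is_derive1_comp (is_derive1_ln x1) (is_derive_addc 1 x).
  have d2 := is_derive1_comp (is_derive1_ln xz) (is_derive_addc z x).
  have /is_derive_eq := is_deriveZ (z - 1)^-1 (is_deriveB d1 d2); apply.
  rewrite /GRing.scale/= !powR_inv1 ?ltW//.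
  by field; rewrite z10 !gt_eqF.
have -> : (z - 1)^-1 * ln z = 0 - ((z - 1)^-1 * (0 - ln z)) by ring.
apply: (pint_FTC _ _ _ _ _ _ d).
- by move=> x x0; continuous_tac; lra.
- by move=> x x0; rewrite mulr_ge0 ?powR_ge0.
- apply: cvg_at_right_filter; apply: cvgM; first exact: cvg_cst.
  have H c : 0 < c -> ln (c + x) @[x --> (0 : R)] --> ln c.
    move=> c0.
    have H0 : {for (0 : R), continuous (fun y => c + y)} by continuous_tac.
    have := @continuous_comp _ _ _ _ (@ln R) _ H0.
    by rewrite /prop_for /continuous_at /= addr0; apply; exact: continuous_ln.
  apply: cvgB; last exact: H.
  by have := H 1 ltr01; rewrite ln1.
- rewrite -[X in _ --> X](mulr0 (z - 1)^-1); apply: cvgM; first exact: cvg_cst.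
  (* The quotient [(1 + x) / (z + x)] equals [1 + (1 - z) / (z + x)], so its logarithm tends to
     [ln 1]. *)
  have H : 1 + (1 - z) * (z + x) `^ (- 1) @[x --> +oo] -->
      (1 + (1 - z) * 0 : R).
    apply: cvgD; first exact: cvg_cst.
    by apply: cvgM; [exact: cvg_cst|exact: cvgy_add_powRN].
  rewrite mulr0 addr0 in H.
  suff : ln (1 + x) - ln (z + x) @[x --> +oo] --> ln (1 : R) by rewrite ln1.
  have C : {for (1 : R), continuous (@ln R)} by exact: continuous_ln.
  apply: cvg_trans (@continuous_cvg _ _ _ _ _ _ _ _ C H).
  apply: near_eq_cvg; near=> x.
  have x0 : 0 < x by near: x; exact: nbhs_pinfty_gt.
  rewrite /= powR_inv1; last lra.
  rewrite -ln_div ?posrE; [|lra|lra].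
  by congr ln; field; rewrite gt_eqF//; lra.
Unshelve. all: by end_near. Qed.

(** Off [z = 1] this is [ln (z * z) = 2 * ln z] and [z * z - 1 = (z - 1) * (z + 1)]; at [z = 1],
    where the closed form is 0/0, the two integrands coincide. *)
Lemma pint_inv_mul_sqr z : 0 < z ->
  ((1 + z)%:E * pint (fun x => (1 + x) `^ (-1) * (z * z + x) `^ (-1))%R =
   2%:E * pint (fun x => (1 + x) `^ (-1) * (z + x) `^ (-1))%R)%E.
Proof.
move=> z0; have [->|z1] := eqVneq z 1; first by rewrite mulr1.
have zz1 : z * z != 1.
  have -> : (z * z != 1) = ((z - 1) * (z + 1) != 0).
    by rewrite -subr_eq0; congr (_ != _); ring.
  by rewrite mulf_neq0 ?subr_eq0// gt_eqF; lra.
rewrite !pint_inv_mul ?mulr_gt0// -!EFinM lnM ?posrE//; congr (_%:E).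
by field; rewrite !subr_eq0 zz1 z1.
Qed.

Lemma pint_square (G : R -> R) : (forall y, 0 < y -> {for y, continuous G}) ->
  (forall y, 0 < y -> 0 <= G y) -> pint G = pint (fun x => G (x * x) * (2 * x)).
Proof.
move=> cG G0.
have d (x : R) : 0 < x -> is_derive x 1 (fun x => x * x) (2 * x).
  move=> _.
  have /is_derive_eq := is_deriveM (is_derive_id x 1) (is_derive_id x 1).
  by apply; rewrite /GRing.scale/=; ring.
apply: (pint_subst `]0, +oo[ (fun x => x * x) (fun x => 2 * x) _ d) => //.
- by move=> x x0; rewrite mulr_gt0.
- by move=> x x0; continuous_tac.
- apply/seteqP; split=> x /=; rewrite in_itv/= andbT.
    by move=> [y /=]; rewrite !in_itv/= !andbT => y0 <-; exact: mulr_gt0.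
  move=> x0; exists (Num.sqrt x); first by rewrite /= in_itv/= andbT sqrtr_gt0.
  by rewrite -expr2 sqr_sqrtr// ltW.
- by move=> y /=; rewrite in_itv/= andbT; exact: cG.
- by move=> y /=; rewrite in_itv/= andbT; exact: G0.
Qed.

(** This is beta(s, 1-s); the reciprocal is kept as a power so that [measurable_tac] and
    [continuous_tac] handle it. *)
Definition eReflBeta s : \bar R :=
  pint (fun u => u `^ (s - 1) * (1 + u) `^ (-1)).

(** [L] is ln z / (z-1) in an integral form that also covers [z = 1]; [M] is the multiplicative
    self-convolution of 1 / (1+w^2). *)
Let L z := pint (fun x => (1 + x) `^ (-1) * (z + x) `^ (-1)).
Let M z := pint (fun x => x * ((1 + x * x) `^ (-1) * (z * z + x * x) `^ (-1))).

Let L_sqr z : 0 < z -> L (z * z) = (2%:E * M z)%E.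
Proof.
move=> z0; have zz := mulr_gt0 z0 z0; rewrite /L pint_square; last 2 first.
- by move=> y y0; continuous_tac; lra.
- by move=> y y0; rewrite mulr_ge0 ?powR_ge0.
rewrite /M -pintZ//; last 2 first.
- by measurable_tac.
- by move=> x x0; rewrite !mulr_ge0 ?powR_ge0// ltW.
by apply: eq_pint => x x0; ring.
Qed.

Let eReflBeta_sqr s : (eReflBeta s * eReflBeta s =
  \int[@lebesgue_measure R]_(z in `]0%R, +oo[)
    pint (fun x => z `^ (s - 1) * ((1 + x) `^ (-1) * (z + x) `^ (-1)))%R)%E.
Proof.
rewrite /eReflBeta mellin_square; last 3 first.
- by measurable_tac.
- by move=> x; exact: powR_ge0.
- by move=> x x0; continuous_tac; lra.
apply: eq_integral => z; rewrite inE/= in_itv/= andbT => z0.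
apply: eq_pint => x x0; congr (_ * _); rewrite (powR_inv1 (ltW x0)) mulrCA.
congr (_ * _); have zx : 0 < z / x by rewrite divr_gt0.
rewrite !powR_inv1; [|lra|lra].
by field; rewrite !gt_eqF//; lra.
Qed.

(** Substituting [u = w * w] before squaring gives the Mellin exponent [2 * r] and the kernel
    [2 / (1 + w * w)]. At [r = s / 2] and [r = (s + 1) / 2] the weights are z^(s-1) and z^s, whose
    sum carries the factor [1 + z]. *)
Let eReflBeta_half_sqr r : (eReflBeta r * eReflBeta r =
  \int[@lebesgue_measure R]_(z in `]0%R, +oo[)
    pint (fun x => z `^ (2 * r - 1) *
      (4 * (x * ((1 + x * x) `^ (-1) * (z * z + x * x) `^ (-1)))))%R)%E.
Proof.
have -> : eReflBeta r =
    pint (fun w => w `^ (2 * r - 1) * (2 * (1 + w * w) `^ (-1))).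
  rewrite /eReflBeta pint_square; last 2 first.
  - by move=> y y0; continuous_tac; lra.
  - by move=> y y0; rewrite mulr_ge0 ?powR_ge0.
  apply: eq_pint => w w0; rewrite powRM ?ltW// -gt0_powRD//.
  have -> : w `^ (2 * r - 1) = w `^ (r - 1 + (r - 1)) * w.
    rewrite -[X in _ = _ * X]powRr1 ?ltW// -gt0_powRD//.
    by congr (_ `^ _); ring.
  by ring.
rewrite mellin_square; last 3 first.
- by measurable_tac.
- by move=> x; rewrite mulr_ge0 ?powR_ge0.
- by move=> x x0; have xx := mulr_gt0 x0 x0; continuous_tac; lra.
apply: eq_integral => z; rewrite inE/= in_itv/= andbT => z0.
apply: eq_pint => x x0; congr (_ * _); rewrite (powR_inv1 (ltW x0)).
have xx := mulr_gt0 x0 x0; have zz := mulr_gt0 z0 z0.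
have zx : 0 < z / x * (z / x) by rewrite mulr_gt0// divr_gt0.
rewrite !powR_inv1; [|lra|lra|lra].
by field; rewrite !gt_eqF//; lra.
Qed.

(** For each [z] the inner integrals on the left add up to 4 z^(s-1) (1+z) M(z) = 2 z^(s-1) (1+z)
    L(z^2), which is 4 z^(s-1) L(z). *)
Lemma eReflBeta_duplication s :
  (eReflBeta (s / 2) * eReflBeta (s / 2) +
   eReflBeta ((s + 1) / 2) * eReflBeta ((s + 1) / 2) =
   4%:E * (eReflBeta s * eReflBeta s))%E.
Proof.
rewrite (eReflBeta_sqr s) (eReflBeta_half_sqr (s / 2)).
rewrite (eReflBeta_half_sqr ((s + 1) / 2)) -ge0_integralD//; last 4 first.
- move=> z _; apply: pint_ge0 => x x0.
  by rewrite !mulr_ge0 ?powR_ge0// ltW.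
- apply: measurable_pint; first by measurable_tac.
  by move=> x y _ y0; rewrite !mulr_ge0 ?powR_ge0// ltW.
- move=> z _; apply: pint_ge0 => x x0.
  by rewrite !mulr_ge0 ?powR_ge0// ltW.
- apply: measurable_pint; first by measurable_tac.
  by move=> x y _ y0; rewrite !mulr_ge0 ?powR_ge0// ltW.
rewrite -ge0_integralZl_EFin//; last 2 first.
- move=> z _; apply: pint_ge0 => x x0.
  by rewrite !mulr_ge0 ?powR_ge0.
- apply: measurable_pint; first by measurable_tac.
  by move=> x y _ _; rewrite !mulr_ge0 ?powR_ge0.
apply: eq_integral => z; rewrite inE/= in_itv/= andbT => z0.
have -> : 2 * (s / 2) - 1 = s - 1 by field.
have -> : 2 * ((s + 1) / 2) - 1 = s by field.
have M0 : (0 <= M z)%E.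
  by apply: pint_ge0 => x x0; rewrite !mulr_ge0 ?powR_ge0// ltW.
have E k : 0 <= k -> pint (fun x => k * (4 * (x * ((1 + x * x) `^ (-1) *
    (z * z + x * x) `^ (-1))))) = ((k * 4)%:E * M z)%E.
  move=> k0; rewrite /M -pintZ//.
  - by apply: eq_pint => x x0; ring.
  - by rewrite mulr_ge0.
  - by measurable_tac.
  - by move=> x x0; rewrite !mulr_ge0 ?powR_ge0// ltW.
have z1 := powR_ge0 z (s - 1); have z2 := powR_ge0 z s.
transitivity ((z `^ (s - 1) * 4)%:E * M z + (z `^ s * 4)%:E * M z)%E.
  by congr (_ + _)%E; [exact: E z1|exact: E z2].
transitivity (4%:E * ((z `^ (s - 1))%:E * L z))%E; last first.
  congr (_ * _)%E; apply/esym; apply: pintZ => //; first by measurable_tac.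
  by move=> x x0; rewrite mulr_ge0 ?powR_ge0.
have := pint_inv_mul_sqr z z0; rewrite -/(L (z * z)) -/(L z) L_sqr//.
move: (M z) (L z) M0 => m l m0 H.
have -> : (4%:E * ((z `^ (s - 1))%:E * l) =
    (2 * z `^ (s - 1))%:E * (2%:E * l))%E.
  by rewrite !muleA -!EFinM; congr (_%:E * _)%E; ring.
rewrite -H -ge0_muleDl ?lee_fin ?mulr_ge0// !muleA -!EFinM -EFinD.
congr (_%:E * _)%E.
have -> : z `^ s = z `^ (s - 1) * z.
  by rewrite -[X in _ = _ * X]powRr1 ?ltW// -gt0_powRD// subrK.
by ring.
Qed.

End beta_duplication.

(** * Size of beta(s, 1-s) and of (pi / sin (pi s))^2 near the endpoints *)

Section reflection.
Context {R : realType}.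
Implicit Types (s u x : R).

(* Bounds [beta(s, 1-s)] through [beta(s, 1) + beta(1, 1-s) = 1/s + 1/(1-s)]. *)
Lemma beta_integrand_bounds s u : 0 < s < 1 -> 0 < u ->
  u `^ (s - 1) * (1 + u) `^ (-1) <=
    u `^ (s - 1) * (1 + u) `^ (- s - 1) + (1 + u) `^ (s - 2) <=
    u `^ (s - 1) * (1 + u) `^ (-1) + (1 + u) `^ (- 2).
Proof.
move=> /andP[s0 s1] u0.
set f := u `^ (s - 1) * (1 + u) `^ (-1).
set g := u `^ (s - 1) * (1 + u) `^ (- s - 1) + _.
have u1 : 0 < 1 + u by lra.
(* With x = ((1+u)/u)^(1-s) and y = (1+u)^s one has [f = q * (x * y)] and [g = q * (x + y)]. The
   right bound is (x-1)(y-1) >= 0. The left one is 1/x + 1/y >= 1, where [X] = 1/x >= u/(1+u) and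
   [Y] = 1/y >= 1/(1+u). *)
pose q := (1 + u) `^ (- 2); pose y := (1 + u) `^ s; pose Y := (1 + u) `^ (- s).
pose x := u `^ (s - 1) * (1 + u) `^ (1 - s).
pose X := u `^ (1 - s) * (1 + u) `^ (s - 1).
have fE : f = q * (x * y).
  rewrite /f /q /x /y -[in RHS]mulrA -gt0_powRD// mulrCA -gt0_powRD//.
  by congr (_ * _ `^ _); ring.
have gE : g = q * (x + y).
  rewrite /g mulrDr /q /x /y mulrCA -!gt0_powRD//.
  by congr (_ * _ `^ _ + _ `^ _); ring.
have xX : x * X = 1.
  rewrite /x /X mulrACA -!gt0_powRD//.
  have -> : s - 1 + (1 - s) = 0 by ring.
  have -> : 1 - s + (s - 1) = 0 by ring.
  by rewrite !powRr0 mulr1.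
have yY : y * Y = 1 by rewrite -gt0_powRD// subrr powRr0.
have x0 : 0 < x by rewrite mulr_gt0 ?powR_gt0.
have X0 : 0 < X by rewrite mulr_gt0 ?powR_gt0.
have y1 : 1 <= y by rewrite -(powRr0 (1 + u)) ler_powR ?ltW//; lra.
have us : u `^ s <= (1 + u) `^ s.
  by apply: ge0_ler_powR; rewrite ?nnegrE ?ltW//; lra.
have us1 : u `^ (1 - s) <= (1 + u) `^ (1 - s).
  by apply: ge0_ler_powR; rewrite ?nnegrE ?ltW//; lra.
have X1 : X <= 1.
  have <- : (1 + u) `^ (1 - s) * (1 + u) `^ (s - 1) = 1.
    by rewrite -gt0_powRD// addrA subrK subrr powRr0.
  by rewrite ler_wpM2r// powR_ge0.
have x1 : 1 <= x by nra.
have Yw : (1 + u) `^ (-1) <= Y by rewrite ler_powR; lra.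
have Xv : u * (1 + u) `^ (-1) <= X.
  have -> : u = u `^ (1 - s) * u `^ s.
    by rewrite -gt0_powRD// subrK powRr1 ?ltW.
  have -> : (1 + u `^ (1 - s) * u `^ s) = 1 + u.
    by rewrite -gt0_powRD// subrK powRr1 ?ltW.
  have -> : (1 + u) `^ (-1) = (1 + u) `^ (s - 1) * (1 + u) `^ (- s).
    by rewrite -gt0_powRD//; congr (_ `^ _); ring.
  have : u `^ s * (1 + u) `^ (- s) <= 1.
    by rewrite -[leRHS]yY ler_wpM2r// powR_ge0.
  rewrite -(ler_pM2l X0) mulr1 /X; nra.
have XY : 1 <= X + Y.
  have : (1 + u) * (1 + u) `^ (-1) = 1.
    by rewrite powR_inv1 ?ltW// mulfV ?gt_eqF.
  lra.
have q0 : 0 < q by rewrite powR_gt0.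
rewrite fE gE -/q; apply/andP; split.
  rewrite ler_pM2l//.
  have -> : x + y = x * y * (X + Y) + (1 - x * X) * y + (1 - y * Y) * x by ring.
  rewrite xX yY !subrr !mul0r !addr0 ler_peMr// mulr_ge0 ?ltW//; lra.
have -> : q * (x * y) + q = q * (x * y + 1) by ring.
by rewrite ler_pM2l//; nra.
Qed.

(** Integrating the pointwise bounds, the reciprocals are beta(s, 1) and beta(1, 1-s), and the slack
    1 is the integral of (1+u)^(-2). Finiteness of [eReflBeta s] follows from the upper bound. *)
Lemma eReflBeta_bounds s : 0 < s < 1 ->
  (eReflBeta s <= (s^-1 + (1 - s)^-1)%:E)%E /\
  ((s^-1 + (1 - s)^-1)%:E <= eReflBeta s + 1)%E.
Proof.
move=> s01; have /andP[s0 s1] := s01.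
have gE : pint (fun u => u `^ (s - 1) * (1 + u) `^ (- s - 1) +
    (1 + u) `^ (s - 2)) = (s^-1 + (1 - s)^-1)%:E.
  rewrite pintD; [|by measurable_tac|by measurable_tac
    |by move=> x _; rewrite mulr_ge0 ?powR_ge0|by move=> x _; exact: powR_ge0].
  rewrite pint_powR_add1_powR// pint_add1_powR; last lra.
  rewrite -EFinD; congr (_ + _)%:E; rewrite -invrN; congr (_^-1); ring.
split; rewrite -gE.
  apply: le_pint; [by measurable_tac|by measurable_tac| |].
    by move=> x _; rewrite mulr_ge0 ?powR_ge0.
  by move=> x x0; have /andP[] := beta_integrand_bounds s x s01 x0.
have -> : (eReflBeta s + 1 =
    pint (fun u => u `^ (s - 1) * (1 + u) `^ (-1) + (1 + u) `^ (- 2))%R)%E.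
  rewrite pintD; [|by measurable_tac|by measurable_tac
    |by move=> x _; rewrite mulr_ge0 ?powR_ge0|by move=> x _; exact: powR_ge0].
  rewrite [X in _ = (_ + X)%E]pint_add1_powR; last lra.
  congr (_ + _%:E)%E; have -> : -2 + 1 = -1 :> R by ring.
  by rewrite invrN1 opprK.
apply: le_pint; [by measurable_tac|by measurable_tac| |].
  by move=> x _; rewrite addr_ge0 ?mulr_ge0 ?powR_ge0.
by move=> x x0; have /andP[] := beta_integrand_bounds s x s01 x0.
Qed.

Lemma eReflBeta_ge0 s : (0 <= eReflBeta s)%E.
Proof. by apply: pint_ge0 => x _; rewrite mulr_ge0 ?powR_ge0. Qed.

Definition reflBeta s : R := fine (eReflBeta s).

Lemma eReflBetaE s : 0 < s < 1 -> eReflBeta s = (reflBeta s)%:E.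
Proof.
move=> s01; rewrite fineK// ge0_fin_numE ?eReflBeta_ge0//.
by rewrite (le_lt_trans (eReflBeta_bounds s s01).1)// ltry.
Qed.

Lemma reflBeta_bounds s : 0 < s < 1 ->
  s^-1 + (1 - s)^-1 - 1 <= reflBeta s <= s^-1 + (1 - s)^-1.
Proof.
move=> s01; have [] := eReflBeta_bounds s s01.
by rewrite eReflBetaE// -EFinD !lee_fin => ? ?; lra.
Qed.

Lemma reflBeta_duplication s : 0 < s < 1 ->
  reflBeta (s / 2) ^+ 2 + reflBeta ((s + 1) / 2) ^+ 2 = 4 * reflBeta s ^+ 2.
Proof.
move=> s01; have /andP[s0 s1] := s01.
have := eReflBeta_duplication s.
rewrite !eReflBetaE//; [|lra|lra].
by rewrite -!EFinM -EFinD => -[]; rewrite !expr2.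
Qed.

Definition pi_csc_sqr s : R := (pi / sin (pi * s)) ^+ 2.

Lemma sin_pi_gt0 s : 0 < s < 1 -> 0 < sin (pi * s).
Proof.
move=> s01; apply: sin_gt0_pi; have := @pi_gt0 R.
by move: s01; nra.
Qed.

(** A shift by pi/2 turns the second sine into a cosine; what remains is 1/sin^2 x + 1/cos^2 x =
    4/sin^2 (2x). *)
Lemma pi_csc_sqr_duplication s : 0 < s < 1 ->
  pi_csc_sqr (s / 2) + pi_csc_sqr ((s + 1) / 2) = 4 * pi_csc_sqr s.
Proof.
move=> s01; have /andP[s0 s1] := s01.
rewrite /pi_csc_sqr.
have -> : pi * ((s + 1) / 2) = pi * (s / 2) + pi / 2 by field.
rewrite sinDpihalf.
have -> : sin (pi * s) = 2 * sin (pi * (s / 2)) * cos (pi * (s / 2)).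
  have -> : pi * s = (pi * (s / 2)) *+ 2 by field.
  by rewrite sin_mulr2n; ring.
have S0 : 0 < sin (pi * (s / 2)) by apply: sin_pi_gt0; lra.
have C0 : 0 < cos (pi * (s / 2)).
  by apply: cos_gt0_pihalf; have := @pi_gt0 R; nra.
have := cos2Dsin2 (pi * (s / 2)).
move: (sin _) (cos _) S0 C0 => S C S0 C0 SC.
have -> : (pi / S) ^+ 2 + (pi / C) ^+ 2 =
    (C ^+ 2 + S ^+ 2) * (pi / (S * C)) ^+ 2.
  by field; rewrite !gt_eqF.
by rewrite SC; field; rewrite !gt_eqF.
Qed.

Lemma sin_le_id x : 0 <= x -> sin x <= x.
Proof.
move=> x0.
have d y : y \in `]0, x[%R ->
    is_derive y 1 (fun y => y - sin y) (1 - cos y).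
  by move=> _; apply: is_deriveB.
have [|c _] := MVT_segment x0 d.
  by apply: derivable_within_continuous => y _; apply: derivableB.
have := cos_le1 c; rewrite sin0 !subr0; nra.
Qed.

(** This is x <= tan x freed of its denominator, so that pi/2 is included. *)
Lemma mul_cos_le_sin x : 0 <= x -> x <= pi / 2 -> x * cos x <= sin x.
Proof.
move=> x0 xp.
have d (y : R) : is_derive y 1 (fun y => sin y - y * cos y) (y * sin y).
  have /is_derive_eq := is_deriveB (is_derive_sin y)
    (is_deriveM (is_derive_id y 1) (is_derive_cos y)); apply.
  by rewrite /GRing.scale/=; ring.
have [|c] := MVT_segment x0 (fun y _ => d y).
  apply: derivable_within_continuous => y _.
  by apply: ex_derive; exact: d.
rewrite in_itv/= => /andP[c0 cx]; rewrite sin0 mul0r !subr0 => H.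
have : 0 <= sin c by apply: sin_ge0_pi; have := @pi_gt0 R; lra.
by move=> sc; rewrite -subr_ge0 H !mulr_ge0.
Qed.

Lemma pi_le4 : pi <= 4 :> R.
Proof. by have [/andP[_ +] _] := @pihalf_02_cos_pihalf R; lra. Qed.

(** For x = pi s, the bounds x cos x <= sin x <= x give 1/x^2 <= 1/sin^2 x = 1 + cot^2 x <= 1 +
    1/x^2. Multiplying by pi^2 <= 16 yields the claim. *)
Lemma pi_csc_sqr_bounds s : 0 < s <= 1 / 2 ->
  s ^- 2 <= pi_csc_sqr s <= s ^- 2 + 16.
Proof.
move=> /andP[s0 s1]; have p0 := @pi_gt0 R; have p4 := pi_le4.
have x0 : 0 < pi * s by rewrite mulr_gt0.
have S0 : 0 < sin (pi * s) by apply: sin_pi_gt0; lra.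
have S1 := sin_le_id (pi * s) (ltW x0).
have S2 : pi * s * cos (pi * s) <= sin (pi * s).
  by apply: mul_cos_le_sin; nra.
have C0 : 0 <= cos (pi * s) by apply: cos_ge0_pihalf; nra.
have SC := cos2Dsin2 (pi * s).
have -> : pi_csc_sqr s = pi ^+ 2 / sin (pi * s) ^+ 2.
  by rewrite /pi_csc_sqr expr_div_n.
move: (sin _) (cos _) S0 S1 S2 C0 SC => S C S0 S1 S2 C0 SC.
have S20 : 0 < S ^+ 2 by rewrite exprn_gt0.
have s20 : 0 < s ^+ 2 by rewrite exprn_gt0.
apply/andP; split.
  rewrite ler_pdivlMr// mulrC ler_pdivrMr// -exprMn.
  by rewrite ler_sqr ?nnegrE//; exact: ltW.
rewrite ler_pdivrMr//.
have K : (pi * s) ^+ 2 * C ^+ 2 <= S ^+ 2.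
  rewrite -exprMn ler_sqr ?nnegrE//; last exact: ltW.
  by rewrite mulr_ge0// ltW.
have K2 : pi ^+ 2 <= 16 :> R by nra.
have -> : pi ^+ 2 = s ^- 2 * ((pi * s) ^+ 2 * (C ^+ 2 + S ^+ 2)).
  by rewrite SC mulr1; field; rewrite gt_eqF.
have -> : s ^- 2 * ((pi * s) ^+ 2 * (C ^+ 2 + S ^+ 2)) =
  s ^- 2 * ((pi * s) ^+ 2 * C ^+ 2) + pi ^+ 2 * S ^+ 2.
  by field; rewrite gt_eqF.
rewrite [leRHS]mulrDl lerD//.
  by rewrite ler_pM2l// invr_gt0.
by rewrite ler_pM2r.
Qed.

End reflection.

(** * Herglotz' contraction and the value of beta(s, 1-s) *)

Section reflection_formula.
Context {R : realType}.
Implicit Types (a b s : R).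

(** With W(s) = 1/s + 1/(1-s), a bound |D| <= K W yields 4 |D(s)| <= K (W(s/2) + W((s+1)/2)) <= 3 K
    W(s); iteration makes the constant decay like (3/4)^n. *)
Lemma herglotz_vanish (D : R -> R) (C : R) :
  (forall s, 0 < s < 1 -> D (s / 2) + D ((s + 1) / 2) = 4 * D s) ->
  (forall s, 0 < s < 1 -> `|D s| <= C * (s^-1 + (1 - s)^-1)) ->
  forall s, 0 < s < 1 -> D s = 0.
Proof.
move=> Ddup DC.
have contr n s : 0 < s < 1 ->
    `|D s| <= C * (3 / 4) ^+ n * (s^-1 + (1 - s)^-1).
  elim: n s => [|n IH] s s01; first by rewrite expr0 mulr1; exact: DC.
  have /andP[s0 s1] := s01.
  (* The sign is read off the bound itself: a norm lies below it and the weight is positive. *)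
  have C0 : 0 <= C * (3 / 4) ^+ n.
    have := le_trans (normr_ge0 _) (IH _ s01); rewrite pmulr_lge0//.
    by rewrite addr_gt0// invr_gt0// subr_gt0.
  have I1 := IH (s / 2); have I2 := IH ((s + 1) / 2).
  have {}I1 := I1 ltac:(lra); have {}I2 := I2 ltac:(lra).
  have N : `|D (s / 2) + D ((s + 1) / 2)| <= `|D (s / 2)| + `|D ((s + 1) / 2)|.
    exact: ler_normD.
  rewrite Ddup// normrM ger0_norm// in N.
  pose W (u : R) := u^-1 + (1 - u)^-1.
  (* The left side is 2 W(s) + 6 / ((2-s)(1+s)), and the last term is at most W(s) = 1 / (s(1-s))
     because s(1-s) <= 1/4. *)
  have W3 : W (s / 2) + W ((s + 1) / 2) <= 3 * W s.
    rewrite /W -subr_ge0.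
    have -> : 3 * (s^-1 + (1 - s)^-1) - ((s / 2)^-1 + (1 - s / 2)^-1 +
        (((s + 1) / 2)^-1 + (1 - (s + 1) / 2)^-1)) =
        (s * (1 - s))^-1 - 6 / ((2 - s) * (1 + s)).
      by field; rewrite !gt_eqF//; lra.
    rewrite subr_ge0 ler_pdivrMr; last nra.
    by rewrite mulrC ler_pdivlMr; nra.
  rewrite -/(W _) in I1; rewrite -/(W _) in I2; rewrite -/(W _).
  rewrite exprS; nra.
move=> s s01; apply/eqP; rewrite -normr_le0.
have cv : (C * (s^-1 + (1 - s)^-1)) * (3 / 4) ^+ n @[n --> \oo] --> (0 : R).
  by apply: cvg_geometric; rewrite ger0_norm; lra.
rewrite -(cvg_lim _ cv)//; apply: limr_ge; first by apply/cvg_ex; exists 0.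
by near=> n; rewrite mulrAC; exact: contr.
Unshelve. all: by end_near. Qed.

(** The double poles of the two squares cancel in [D], so the contraction applies and the squares
    agree; both functions being positive, they agree too. *)
Lemma reflBetaE s : 0 < s < 1 -> reflBeta s = pi / sin (pi * s).
Proof.
move=> s01; pose D (u : R) := reflBeta u ^+ 2 - pi_csc_sqr u.
have D0 : D s = 0.
  apply: (herglotz_vanish D 16) => // {}s {}s01.
    have := reflBeta_duplication s s01; have := pi_csc_sqr_duplication s s01.
    move=> HV HB; rewrite /D mulrBr -HV -HB; ring.
  (* With v = 1/u >= 2 and 1/(1-u) in [1, 2], the hypotheses give v <= B <= v + 2 and v^2 <= V <=
     v^2 + 16, so B^2 - V lies between -16 and 4v + 4. *)
  have half (u B V : R) : 0 < u <= 1 / 2 -> u^-1 + (1 - u)^-1 - 1 <= B ->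
      B <= u^-1 + (1 - u)^-1 -> u ^- 2 <= V -> V <= u ^- 2 + 16 ->
      `|B ^+ 2 - V| <= 16 * (u^-1 + (1 - u)^-1).
    rewrite -exprVn => /andP[u0 u2] B1 B2 V1 V2.
    have v2 : 2 <= u^-1 by rewrite -(ler_pM2l u0) mulfV ?gt_eqF//; lra.
    have w1 : 1 <= (1 - u)^-1 by rewrite invf_ge1; lra.
    have w2 : (1 - u)^-1 <= 2.
      by rewrite -[leLHS]div1r ler_pdivrMr; lra.
    rewrite ler_norml; apply/andP; split.
      nra.
    nra.
  have /andP[B1 B2] := reflBeta_bounds s s01.
  have [s2|s2] := leP s (1 / 2).
    have s12 : 0 < s <= 1 / 2 by lra.
    by have /andP[V1 V2] := pi_csc_sqr_bounds s s12; exact: half.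
  (* Past 1/2 the estimate is used at [1 - s]: the bounds on [reflBeta s] and the value of
     [pi_csc_sqr] are both symmetric. *)
  have s12 : 0 < 1 - s <= 1 / 2 by lra.
  have /andP[V1 V2] := pi_csc_sqr_bounds (1 - s) s12.
  have VE : pi_csc_sqr (1 - s) = pi_csc_sqr s.
    rewrite /pi_csc_sqr mulrBr mulr1 sinB sinpi cospi mul0r sub0r mulN1r opprK.
    by [].
  rewrite VE in V1 V2; have := half (1 - s) (reflBeta s) (pi_csc_sqr s).
  by rewrite subKr (addrC (1 - s)^-1); apply.
have sin0 := sin_pi_gt0 s s01.
have B0 : 0 < reflBeta s.
  have /andP[B1 _] := reflBeta_bounds s s01.
  have h1 : 1 < s^-1 by rewrite invf_gt1; lra.
  have h2 : 1 < (1 - s)^-1 by rewrite invf_gt1; lra.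
  lra.
apply/eqP; rewrite -(@eqrXn2 _ 2) ?ltW ?divr_gt0 ?pi_gt0//.
by rewrite -subr_eq0; apply/eqP.
Qed.

End reflection_formula.

(** * Weyl integral of a power *)

Section gamma.
Context {R : realType}.
Implicit Types (a b s : R).

Lemma eGamma1 : eGamma (1 : R) = 1%E.
Proof.
by rewrite -pint_expRN; apply: eq_pint => x _; rewrite subrr powRr0 mul1r.
Qed.

(** Since exp(-x) <= 1/(1+x), the Gamma integral lies below the finite beta(s, 1-s). *)
Lemma eGammaE s : 0 < s < 1 -> eGamma s = (Gamma s)%:E.
Proof.
move=> s01; rewrite /Gamma -/(pint _) -/(eGamma s) fineK//.
rewrite ge0_fin_numE ?eGamma_ge0// (@le_lt_trans _ _ (eReflBeta s))//.
  apply: le_pint; [by measurable_tac|by measurable_tac| |].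
    by move=> x _; rewrite mulr_ge0 ?powR_ge0 ?expR_ge0.
  move=> x x0; rewrite ler_wpM2l ?powR_ge0// powR_inv1; last lra.
  by rewrite expRN lef_pV2 ?posrE ?expR_gt0 ?expR_ge1Dx//; lra.
by rewrite eReflBetaE// ltry.
Qed.

Lemma Gamma_reflection s : 0 < s < 1 ->
  Gamma s * Gamma (1 - s) = pi / sin (pi * s).
Proof.
move=> s01; have s01' : 0 < 1 - s < 1 by lra.
have := eGammaM s (1 - s).
have -> : eBeta s (1 - s) = eReflBeta s.
  by apply: eq_pint => x _; rewrite (addrC s (1 - s)) subrK.
rewrite (addrC s (1 - s)) subrK eGamma1 mule1 !eGammaE//.
rewrite eReflBetaE// -EFinM => -[].
by rewrite reflBetaE// mulrC.
Qed.

(** A zero of Gamma would contradict the reflection formula, whose right side is positive. *)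
Lemma Gamma_gt0 s : 0 < s < 1 -> 0 < Gamma s.
Proof.
move=> s01; rewrite lt_neqAle -lee_fin -eGammaE// eGamma_ge0 andbT.
apply/eqP => G0; have := Gamma_reflection s s01; rewrite -G0 mul0r => /eqP.
by rewrite lt_eqF// divr_gt0 ?pi_gt0// sin_pi_gt0.
Qed.

(** The condition [a + b < 1] keeps the sum where Gamma is known to be finite and positive; an
    infinite Beta integral would then make the finite product of Gammas infinite. *)
Lemma eBetaE a b : 0 < a < 1 -> 0 < b < 1 -> a + b < 1 ->
  eBeta a b = (Gamma a * Gamma b / Gamma (a + b))%:E.
Proof.
move=> a01 b01 ab1; have ab01 : 0 < a + b < 1 by lra.
have := eGammaM a b; have := Gamma_gt0 _ ab01; rewrite !eGammaE//.
move: (eBeta_ge0 a b); case: (eBeta a b) => [r _ G0| _ G0|//].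
  rewrite -!EFinM => -[E]; congr (_%:E).
  by rewrite (mulrC (Gamma a)) E mulfK// gt_eqF.
by rewrite gt0_mulye.
Qed.

(** After splitting at 0, [t - tau] is t / (1+u) on the positive side and t (1+u) on the negative
    one, so the powers of [t] factor out of two Beta integrands. *)
Lemma integral_weyl_kernel (alpha delta t : R) : 0 < t ->
  (\int[@lebesgue_measure R]_(tau in `]-oo, t])
    ((t - tau) `^ (alpha - 1) * `|tau| `^ (- delta))%:E =
  (t `^ (alpha - delta))%:E *
    (eBeta (1 - delta) alpha + eBeta (1 - delta) (delta - alpha)))%E.
Proof.
move=> t0; pose f tau := (t - tau) `^ (alpha - 1) * `|tau| `^ (- delta).
have f0 x : 0 <= f x by rewrite mulr_ge0 ?powR_ge0.
have mf : measurable_fun setT f.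
  rewrite /f; measurable_tac.
  by apply: measurableT_comp => //; exact: measurable_id.
have mfN : measurable_fun setT (fun x : R => f (- x)).
  by apply: (measurableT_comp mf); apply: measurable_funN; exact: measurable_id.
have -> : `]-oo, t]%classic = `]-oo, 0%R] `|` `]0%R, t] :> set R.
  by rewrite -itv_bndbnd_setU// bnd_simp ltW.
rewrite ge0_integral_setU//=; last 3 first.
- by apply/measurable_EFinP; exact: measurable_funTS.
- by move=> x _; rewrite lee_fin; exact: f0.
- apply/disj_setPS => x [] /=; rewrite !in_itv/= => x0 /andP[]; rewrite ltNge.
  by rewrite x0.
rewrite addeC ge0_muleDr ?eBeta_ge0//; congr (_ + _)%E.
  (* The null endpoint [t] is dropped because the substitution covers only the open interval. *)
  transitivity (\int[@lebesgue_measure R]_(x in `]0%R, t[) (f x)%:E)%E.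
    rewrite -integral_itv_bndo_bndc//.
    by apply/measurable_EFinP; exact: measurable_funTS.
  have d (u : R) : 0 < u -> is_derive u 1 (fun u => t * (u * (1 + u) `^ (-1)))
      (t * (1 + u) `^ (-2)).
    move=> u0; have u1 : 0 < 1 + u by lra.
    have d1 := is_derive_powR (-1) _ _ u u1 (is_derive_addc 1 u).
    have /is_derive_eq :=
      is_deriveZ t (is_deriveM (is_derive_id u 1) d1); apply.
    rewrite /GRing.scale/= mulr1.
    have -> : (1 + u) `^ (-1) = (1 + u) `^ (-2) * (1 + u).
      rewrite -[X in _ = _ * X]powRr1 ?ltW// -gt0_powRD//.
      by congr (_ `^ _); ring.
    have -> : -1 - 1 = -2 :> R by ring.
    ring.
  rewrite (pint_subst `]0, t[ _ _ f d); first last.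
  - by move=> y _; exact: f0.
  - move=> y /=; rewrite in_itv/= => /andP[y0 yt]; rewrite /f; continuous_tac.
    + lra.
    + by rewrite normr_gt0 gt_eqF.
    + exact: norm_continuous.
  - apply/seteqP; split=> y /=; rewrite in_itv/=.
      move=> [u /=]; rewrite in_itv/= andbT => u0 <-.
      have u1 : 0 < 1 + u by lra.
      rewrite powR_inv1 ?ltW// mulr_gt0 ?divr_gt0//= gtr_pMr// ltr_pdivrMr//.
      lra.
    move=> /andP[y0 yt]; have ty : 0 < t - y by lra.
    have u0 : 0 < y / (t - y) by rewrite divr_gt0.
    (* Solution [u] of t u / (1+u) = y. *)
    exists (y / (t - y)); first by rewrite /= in_itv/= andbT.
    rewrite powR_inv1; last lra.
    by field; rewrite subrK !gt_eqF.
  - by move=> u u0; continuous_tac; lra.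
  - by move=> u u0; rewrite mulr_gt0 ?powR_gt0//; lra.
  apply: etrans (pintZ _ _ (powR_ge0 _ _) _ _); last 2 first.
  - by measurable_tac.
  - by move=> x _; rewrite mulr_ge0 ?powR_ge0.
  apply: eq_pint => u u0; have u1 : 0 < 1 + u by lra.
  have w0 : 0 < (1 + u) `^ (-1) by rewrite powR_gt0.
  have -> : f (t * (u * (1 + u) `^ (-1))) =
      (t * (1 + u) `^ (-1)) `^ (alpha - 1) *
      (t * (u * (1 + u) `^ (-1))) `^ (- delta).
    rewrite /f ger0_norm ?mulr_ge0 ?ltW//; congr (_ `^ _ * _).
    by rewrite powR_inv1 ?ltW//; field; rewrite gt_eqF.
  rewrite !powRM ?mulr_ge0 ?ltW// -!powRrM.
  have -> : t `^ (alpha - delta) = t `^ (alpha - 1) * t `^ (- delta) * t.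
    rewrite -[X in _ = _ * X]powRr1 ?ltW// -!gt0_powRD//.
    by congr (_ `^ _); ring.
  (* The three factors come from [t - tau], from [tau] and from the derivative of the
     substitution. *)
  have -> : (1 + u) `^ (- (1 - delta + alpha)) = (1 + u) `^ (-1 * (alpha - 1)) *
      (1 + u) `^ (-1 * - delta) * (1 + u) `^ (-2).
    by rewrite -!gt0_powRD//; congr (_ `^ _); ring.
  have -> : 1 - delta - 1 = - delta by ring.
  ring.
(* On the negative side, the reflection [tau = - x] is followed by the scaling [x = t * u]. *)
transitivity (pint (fun x => f (- x))).
  rewrite /pint integral_itv_obnd_cbnd; last first.
    by apply/measurable_EFinP; exact: measurable_funTS.
  have mfN' : measurable_fun setT (fun x : R => (f (- x))%:E).
    exact/measurable_EFinP.
  rewrite (ge0_integration_by_substitution0 mfN' (fun x => f0 (- x))).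
  by apply: eq_integral => x _; rewrite opprK.
rewrite (pint_scale t)//; last first.
  move=> y y0; rewrite /f; continuous_tac.
  - lra.
  - by rewrite normr_gt0 oppr_eq0 gt_eqF.
  - apply: (@continuous_comp _ _ _ -%R (fun x : R => `|x|)).
      exact: oppr_continuous.
    exact: norm_continuous.
apply: etrans (pintZ _ _ (powR_ge0 _ _) _ _); last 2 first.
- by measurable_tac.
- by move=> x _; rewrite mulr_ge0 ?powR_ge0.
apply: eq_pint => u u0; have u1 : 0 < 1 + u by lra.
rewrite /f normrN ger0_norm ?mulr_ge0 ?ltW//.
have -> : t - - (t * u) = t * (1 + u) by ring.
rewrite !powRM ?ltW//.
have -> : t `^ (alpha - delta) = t `^ (alpha - 1) * t `^ (- delta) * t.
  rewrite -[X in _ = _ * X]powRr1 ?ltW// -!gt0_powRD//.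
  by congr (_ `^ _); ring.
have -> : 1 - delta - 1 = - delta by ring.
have -> : - (1 - delta + (delta - alpha)) = alpha - 1 by ring.
ring.
Qed.

(** For x = pi delta / 2 and y = x - pi alpha, the left side is sin (x+y) + sin (x-y) = 2 sin x cos
    y, while sin (pi delta) = 2 sin x cos x with cos x > 0. *)
Lemma sin_add_sin_pi (alpha delta : R) : 0 < delta < 1 ->
  sin (pi * (delta - alpha)) + sin (pi * alpha) =
  sin (pi * delta) * (cos (pi * delta / 2 - pi * alpha) / cos (pi * delta / 2)).
Proof.
move=> /andP[d0 d1]; have p0 := @pi_gt0 R.
have pd0 : 0 < pi * delta by exact: mulr_gt0.
have pd1 : pi * delta < pi by rewrite gtr_pMr.
have C0 : cos (pi * delta / 2) != 0.
  by rewrite gt_eqF//; apply: cos_gt0_pihalf; lra.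
pose x := pi * delta / 2; pose y := x - pi * alpha.
have -> : pi * (delta - alpha) = x + y by rewrite /y /x; field.
have -> : pi * alpha = x - y by rewrite /y; ring.
have -> : pi * delta = x *+ 2 by rewrite /x; field.
have -> : x *+ 2 / 2 = x by field.
have -> : x - (x - y) = y by ring.
rewrite -/x in C0; move: x y C0 => x y C0.
by rewrite sin_mulr2n sinD sinB; field.
Qed.

End gamma.

Theorem theorem2 (R : realType) (alpha delta t : R)
  (ha : 0 < alpha) (had : alpha < delta) (hd : delta < 1) (ht : 0 < t) :
  weyl_integral alpha (fun tau => `|tau| `^ (- delta)) t =
  (Gamma (delta - alpha) / Gamma delta *
   (cos (pi * delta / 2 - pi * alpha) / cos (pi * delta / 2)) *
   t `^ (alpha - delta))%:E.
Proof.
have a01 : 0 < alpha < 1 by lra.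
have d01 : 0 < delta < 1 by lra.
have da01 : 0 < delta - alpha < 1 by lra.
have d01' : 0 < 1 - delta < 1 by lra.
have a01' : 0 < 1 - alpha < 1 by lra.
have da01' : 0 < 1 - (delta - alpha) < 1 by lra.
rewrite /weyl_integral integral_weyl_kernel// !eBetaE//; [|lra|lra].
rewrite -EFinD -!EFinM; congr (_%:E).
have -> : 1 - delta + alpha = 1 - (delta - alpha) by ring.
have -> : 1 - delta + (delta - alpha) = 1 - alpha by ring.
have Rd := Gamma_reflection _ d01; have Ra := Gamma_reflection _ a01.
have Rda := Gamma_reflection _ da01.
have Gd := Gamma_gt0 _ d01; have Ga := Gamma_gt0 _ a01.
have Gda := Gamma_gt0 _ da01; have Gd' := Gamma_gt0 _ d01'.
have Ga' := Gamma_gt0 _ a01'; have Gda' := Gamma_gt0 _ da01'.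
have Sd := sin_pi_gt0 _ d01; have Sa := sin_pi_gt0 _ a01.
have Sda := sin_pi_gt0 _ da01; have p0 := @pi_gt0 R.
have trig := sin_add_sin_pi alpha delta d01.
(* The cosines are traded for the three sines that occur in the reflection formulas. *)
have -> : (cos (pi * delta / 2 - pi * alpha) / cos (pi * delta / 2)) =
    (sin (pi * (delta - alpha)) + sin (pi * alpha)) / sin (pi * delta).
  by rewrite trig [RHS]mulrAC mulfV ?mul1r// gt_eqF.
move: (Gamma delta) (Gamma alpha) (Gamma (delta - alpha)) (Gamma (1 - delta))
  (Gamma (1 - alpha)) (Gamma (1 - (delta - alpha))) (sin (pi * delta))
  (sin (pi * alpha)) (sin (pi * (delta - alpha))) (t `^ (alpha - delta)) pi
  Gd Ga Gda Gd' Ga' Gda' Sd Sa Sda p0 Rd Ra Rda => gd ga gda gd' ga' gda'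
  sd sa sda T p Gd Ga Gda Gd' Ga' Gda' Sd Sa Sda p0 Rd Ra Rda {trig}.
have divE (x y z : R) : 0 < x -> x * y = z -> y = z / x.
  by move=> x0 <-; rewrite [RHS]mulrAC mulfV ?mul1r// gt_eqF.
(* Eliminating Gamma at [1 - delta], [1 - alpha] and [1 - (delta - alpha)] leaves a rational
   identity with positive denominators. *)
rewrite (divE _ _ _ Gd Rd) (divE _ _ _ Ga Ra) (divE _ _ _ Gda Rda).
by field; rewrite !gt_eqF.
Qed.
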